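(* Let $d\in\{2,3\}$, $T>0$, $N\ge 1$ an integer, $\tau=T/N$ and $t^n=n\tau$. Let $(\boldsymbol u^{n},p^{n},\boldsymbol w^{n},q^{n})$ be a solution of the Euler IMEX-SAV scheme (described in the context) with initial data $\boldsymbol u^0,\boldsymbol w^0,q^0$. Define, for $0\le n\le N$, $$E^{n}=\frac12\|\boldsymbol u^{n}\|^2+\frac{\jmath+4\tau\nu_r}{2}\|\boldsymbol w^{n}\|^2+\frac12|q^{n}|^2 .$$ Then the scheme is unconditionally stable (no restriction on $\tau$) in the sense that, for all $0\le n\le N-1$, $$E^{n+1}-E^{n}\le -\tau\nu\|\nabla\boldsymbol u^{n+1}\|^2-\tau c_1\|\nabla\boldsymbol w^{n+1}\|^2-\tau c_2\|\nabla\cdot\boldsymbol w^{n+1}\|^2-\frac{\tau}{T}|q^{n+1}|^2 .$$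
   Context: Setting. $\Omega\subset\mathbb R^d$, $d\in\{2,3\}$, is a convex polygonal/polyhedral domain. $(\cdot,\cdot)$ and $\|\cdot\|$ are the $L^2(\Omega)$ inner product and norm. $\boldsymbol X=\boldsymbol H_0^1(\Omega)$, $\boldsymbol V=\{\boldsymbol v\in\boldsymbol X:\nabla\cdot\boldsymbol v=0\}$. The constants $\jmath,\nu,\nu_r,c_a,c_d,c_0$ are positive with $c_0+c_d-c_a>0$, and $\nu_0=\nu+\nu_r$, $c_1=c_a+c_d$, $c_2=c_0+c_d-c_a$. If $d=2$, the convention is $\boldsymbol u=(u_1,u_2,0)$, $\boldsymbol w=(0,0,w)$ with all functions depending on $(x,y)$ only, so that $\nabla\times\boldsymbol u=(0,0,\partial_xu_2-\partial_yu_1)$ and $\nabla\times\boldsymbol w=(\partial_yw,-\partial_xw,0)$. Scheme. For a sequence $v^n$ put $\delta_tv^{n+1}=(v^{n+1}-v^n)/\tau$. Given $\boldsymbol u^0\in\boldsymbol V$, $\boldsymbol w^0\in\boldsymbol X$, $q^0\in\mathbb R$, for $n=0,1,\dots,N-1$ find $\boldsymbol u^{n+1}\in\boldsymbol X$, $p^{n+1}\in L^2(\Omega)$ of zero mean, $\boldsymbol w^{n+1}\in\boldsymbol X$, $q^{n+1}\in\mathbb R$ such that (PDEs in $\Omega$, in the weak sense) $$\delta_t\boldsymbol u^{n+1}+\frac{q^{n+1}}{\exp(-t^{n+1}/T)}\boldsymbol u^n\cdot\nabla\boldsymbol u^n-\nu_0\Delta\boldsymbol u^{n+1}+\nabla p^{n+1}=2\nu_r\nabla\times\boldsymbol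 w^n,$$ $$\nabla\cdot\boldsymbol u^{n+1}=0,$$ $$\jmath\,\delta_t\boldsymbol w^{n+1}+\jmath\frac{q^{n+1}}{\exp(-t^{n+1}/T)}\boldsymbol u^n\cdot\nabla\boldsymbol w^n-c_1\Delta\boldsymbol w^{n+1}-c_2\nabla\nabla\cdot\boldsymbol w^{n+1}+4\nu_r\boldsymbol w^{n+1}=2\nu_r\nabla\times\boldsymbol u^{n+1},$$ $$\delta_tq^{n+1}+\frac1Tq^{n+1}-\frac{1}{\exp(-t^{n+1}/T)}\Big((\boldsymbol u^n\cdot\nabla\boldsymbol u^n,\boldsymbol u^{n+1})+\jmath(\boldsymbol u^n\cdot\nabla\boldsymbol w^n,\boldsymbol w^{n+1})\Big)=0 .$$ *)

(* Defs.v *)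
From HB Require Import structures.
From mathcomp Require Import all_boot all_order all_algebra.
From mathcomp Require Import all_classical all_reals all_analysis.

Set Implicit Arguments.
Unset Strict Implicit.
Unset Printing Implicit Defensive.

Import Order.TTheory GRing.Theory Num.Theory.
Import numFieldNormedType.Exports.

Local Open Scope classical_set_scope.
Local Open Scope ring_scope.

(** * Lebesgue measure on R^n *)

(* Points of R^n are row vectors. The sigma-algebra is the product one, that is
   the Borel sigma-algebra. *)
Definition rV_display : measure_display.
Proof. exact: default_measure_display. Qed.

Section measurable_rV.
Context {R : realType} {n : nat}.

Let coord_rV : 'I_n -> 'rV[R]_n -> measurableTypeR R := fun i x => x ord0 i.

Let rV_set0 : g_sigma_preimage coord_rV set0.
Proof. exact: sigma_algebra0. Qed.

Let rV_setC A : g_sigma_preimage coord_rV A -> g_sigma_preimage coord_rV (~` A).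
Proof. exact: sigma_algebraC. Qed.

Let rV_bigcup (F : _^nat) : (forall i, g_sigma_preimage coord_rV (F i)) ->
  g_sigma_preimage coord_rV (\bigcup_i (F i)).
Proof. exact: sigma_algebra_bigcup. Qed.

HB.instance Definition _ := @isMeasurable.Build rV_display 'rV[R]_n
  (g_sigma_preimage coord_rV) rV_set0 rV_setC rV_bigcup.

Lemma measurable_coord_rV (i : 'I_n) :
  measurable_fun [set: 'rV[R]_n] (coord_rV i).
Proof.
move=> _ Y mY; rewrite setTI; apply: sub_sigma_algebra => /=.
rewrite -bigcup_seq/=; exists i => /=; first by rewrite mem_index_enum.
by exists Y => //; rewrite setTI.
Qed.

Lemma measurable_fun_rVP d (T : measurableType d) (f : T -> 'rV[R]_n) :
  (forall i, measurable_fun [set: T] (coord_rV i \o f)) ->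
  measurable_fun [set: T] f.
Proof.
move=> mf; apply: (@measurability _ _ _ _ _ _
  (\big[setU/set0]_(i < n) preimage_set_system setT (coord_rV i) measurable)) => //.
move=> _ [B + <-]; rewrite -bigcup_seq/= => -[i _] [C mC <-].
by have := mf i measurableT C mC; rewrite !setTI.
Qed.

End measurable_rV.

Section lebesgue_rV.
Context {R : realType}.

Definition cons_rV n (x : measurableTypeR R * 'rV[R]_n) : 'rV[R]_n.+1 :=
  row_mx (\row_(_ < 1) x.1) x.2.

Definition uncons_rV n (v : 'rV[R]_n.+1) : measurableTypeR R * 'rV[R]_n :=
  (v ord0 ord0, @rsubmx R 1 1 n v).

Lemma measurable_cons_rV n : measurable_fun setT (@cons_rV n).
Proof.
apply: measurable_fun_rVP => i.
case: (@split_ordP 1 n i) => j ->.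
  rewrite [X in measurable_fun _ X](_ : _ = fst)//.
  by apply/funext => x /=; apply: (etrans (row_mxEl _ _ _ _)); rewrite mxE.
rewrite [X in measurable_fun _ X](_ : _ =
  (fun v : 'rV[R]_n => v ord0 j : measurableTypeR R) \o snd).
  by apply: measurableT_comp => //; exact: measurable_coord_rV.
by apply/funext => x /=; exact: row_mxEr.
Qed.

Lemma measurable_uncons_rV n : measurable_fun setT (@uncons_rV n).
Proof.
apply: measurable_fun_pair; first exact: measurable_coord_rV.
apply: measurable_fun_rVP => i.
rewrite [X in measurable_fun _ X](_ : _ =
  (fun v : 'rV[R]_n.+1 => v ord0 (rshift 1 i) : measurableTypeR R)).
  exact: measurable_coord_rV.
by apply/funext => x /=; rewrite mxE.
Qed.

Lemma cons_rVK n : cancel (@cons_rV n) (@uncons_rV n).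
Proof.
move=> [x v]; rewrite /uncons_rV /cons_rV /= row_mxKr; congr pair.
transitivity ((\row_(_ < 1) x : 'rV[R]_1) ord0 ord0); last by rewrite mxE.
have <- := row_mxEl (\row_(_ < 1) x : 'rV[R]_1) v ord0 ord0.
by congr (row_mx _ _ _ _); exact/val_inj.
Qed.

Section lebesgue_rVS.
Variables (n : nat) (m : {sigma_finite_measure set 'rV[R]_n -> \bar R}).

Definition lebesgue_rVS : set 'rV[R]_n.+1 -> \bar R :=
  pushforward (@lebesgue_measure R \x m)%E (@cons_rV n).

Let lebesgue_rVS0 : lebesgue_rVS set0 = 0%E.
Proof. by rewrite /lebesgue_rVS /pushforward preimage_set0 measure0. Qed.

Let lebesgue_rVS_ge0 A : (0 <= lebesgue_rVS A)%E.
Proof. exact: (measure_ge0 (@lebesgue_measure R \x m)%E). Qed.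

Let lebesgue_rVS_sigma_additive : semi_sigma_additive lebesgue_rVS.
Proof.
move=> F mF tF mUF; rewrite /lebesgue_rVS /pushforward preimage_bigcup.
have mcons B : measurable B -> measurable (@cons_rV n @^-1` B).
  by move=> mB; rewrite -[X in measurable X]setTI; exact: measurable_cons_rV.
apply: measure_semi_sigma_additive.
- by move=> k; exact: mcons.
- apply/trivIsetP => /= i j _ _ ij; rewrite -preimage_setI.
  by move/trivIsetP : tF => /(_ _ _ _ _ ij) ->//; rewrite preimage_set0.
- by rewrite -preimage_bigcup; exact: mcons.
Qed.

HB.instance Definition _ := isMeasure.Build _ _ _ lebesgue_rVS
  lebesgue_rVS0 lebesgue_rVS_ge0 lebesgue_rVS_sigma_additive.

Let lebesgue_rVS_sigma_finite : sigma_finite setT lebesgue_rVS.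
Proof.
have /sigma_finiteP[F [TF ndF Foo]] := sigma_finiteT (@lebesgue_measure R).
have /sigma_finiteP[G [TG ndG Goo]] := sigma_finiteT m.
exists (fun k => @uncons_rV n @^-1` (F k `*` G k)).
  apply/esym/seteqP; split=> // v _.
  have [i _ Fi] : (\bigcup_i F i) (@uncons_rV n v).1 by rewrite -TF.
  have [j _ Gj] : (\bigcup_i G i) (@uncons_rV n v).2 by rewrite -TG.
  exists (maxn i j) => //; split.
  - by move: Fi; exact/subsetPset/ndF/leq_maxl.
  - by move: Gj; exact/subsetPset/ndG/leq_maxr.
move=> k; have [mF Fk] := Foo k; have [mG Gk] := Goo k; split.
  by rewrite -[X in measurable X]setTI; apply: measurable_uncons_rV => //;
    exact: measurableX.
rewrite /lebesgue_rVS /pushforward -comp_preimage.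
rewrite (_ : _ \o _ = id); last by apply/funext => x; exact: cons_rVK.
by rewrite preimage_id product_measure1E// lte_mul_pinfty// ge0_fin_numE.
Qed.

HB.instance Definition _ := Measure_isSigmaFinite.Build _ _ _ lebesgue_rVS
  lebesgue_rVS_sigma_finite.

End lebesgue_rVS.

Fixpoint lebesgue_rV n : {sigma_finite_measure set 'rV[R]_n -> \bar R} :=
  match n with
  | 0 => \d_ (0 : 'rV[R]_0)
  | n'.+1 => lebesgue_rVS (lebesgue_rV n')
  end.

End lebesgue_rV.

(** * Function spaces *)

(* Open bounded convex polytopes: finite intersections of open half-spaces. *)
Definition convex_polyhedral_domain {R : realType} d (Omega : set 'rV[R]_d) :=
  [/\ Omega !=set0, bounded_set Omega &
    exists (m : nat) (a : 'I_m -> 'rV[R]_d) (b : 'I_m -> R),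
      Omega = [set x | forall k, \sum_(i < d) a k ord0 i * x ord0 i < b k]].

Section scalar_functions.
Context {R : realType} {d : nat} (Omega : set 'rV[R]_d).
Implicit Types f g u phi : 'rV[R]_d -> R.

Let mu := lebesgue_rV (R := R) d.

Definition L2 f : Prop := f \_ Omega \in Lfun mu 2%:E.

Definition inner f g : R := \int[mu]_(x in Omega) (f x * g x).

Definition L2norm f : R := Num.sqrt (inner f f).

Definition ae_zero f : Prop := {ae mu, forall x, Omega x -> f x = 0}.

Definition partial (i : 'I_d) f : 'rV[R]_d -> R :=
  fun x => 'D_(delta_mx ord0 i) f x.

Definition smooth f : Prop := forall s : seq 'I_d,
  let g := foldr partial f s in
  continuous g /\ forall (i : 'I_d) x, derivable g x (delta_mx ord0 i).

Definition test_function phi : Prop :=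
  let supp := closure [set x | phi x != 0] in
  [/\ smooth phi, compact supp & supp `<=` Omega].

Definition weak_partial (i : 'I_d) u g : Prop :=
  L2 g /\ forall phi, test_function phi ->
    inner u (partial i phi) = - inner g phi.

(* A representative of the L^2 weak partial derivative, which is unique up to a
   null set; 0 if there is none. *)
Definition wpartial (i : 'I_d) u : 'rV[R]_d -> R :=
  xget (fun=> 0) [set g | weak_partial i u g].

Definition H1 u : Prop := L2 u /\ forall i, exists g, weak_partial i u g.

(* H^1_0 is the closure of the test functions in H^1. *)
Definition H10 u : Prop :=
  H1 u /\ forall e : R, 0 < e -> exists phi,
    [/\ test_function phi, L2norm (u - phi) < e &
      forall i, L2norm (wpartial i u - partial i phi) < e].

End scalar_functions.

(* Vector fields have three components in both dimensions. If d = 2, functions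
   depend on (x, y) only, hence the third partial derivative vanishes. *)
Section vector_fields.
Context {R : realType} {d : nat} (Omega : set 'rV[R]_d).

Definition vfield := 'I_3 -> 'rV[R]_d -> R.

Implicit Types u v w : vfield.

Definition wpd (i : 'I_3) (f : 'rV[R]_d -> R) : 'rV[R]_d -> R :=
  if insub (val i) is Some j then wpartial Omega j f else fun=> 0.

Definition divergence u : 'rV[R]_d -> R :=
  fun x => \sum_(i < 3) wpd i (u i) x.

(* Indices are added modulo 3. *)
Definition curl u : vfield :=
  fun k x => wpd (k + 1) (u (k + 2)) x - wpd (k + 2) (u (k + 1)) x.

Definition convection u v : vfield :=
  fun k x => \sum_(i < 3) u i x * wpd i (v k) x.

Definition vinner u v : R := \sum_(k < 3) inner Omega (u k) (v k).

Definition grad_inner u v : R :=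
  \sum_(k < 3) \sum_(i < 3) inner Omega (wpd i (u k)) (wpd i (v k)).

Definition vnorm u : R := Num.sqrt (vinner u u).

Definition grad_norm u : R := Num.sqrt (grad_inner u u).

(* The space X for the velocity, (u_1, u_2, 0) if d = 2, and for the angular
   velocity, (0, 0, w) if d = 2. *)
Definition X_vel u : Prop :=
  (forall k, H10 Omega (u k)) /\ (d = 2 -> ae_zero Omega (u 2)).

Definition X_ang w : Prop :=
  (forall k, H10 Omega (w k)) /\
  (d = 2 -> ae_zero Omega (w 0) /\ ae_zero Omega (w 1)).

Definition V_vel u : Prop := X_vel u /\ ae_zero Omega (divergence u).

Definition L2_zero_mean (p : 'rV[R]_d -> R) : Prop :=
  L2 Omega p /\ \int[lebesgue_rV d]_(x in Omega) p x = 0.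

End vector_fields.

Arguments vfield : clear implicits.

(** * The Euler IMEX-SAV scheme *)

Record coefficients (R : realType) := Coefficients {
  jmath : R; nu : R; nu_r : R; c_a : R; c_d : R; c_0 : R }.

Section scheme.
Context {R : realType} (C : coefficients R).

Definition nu_0 : R := nu C + nu_r C.
Definition c_1 : R := c_a C + c_d C.
Definition c_2 : R := c_0 C + c_d C - c_a C.

Definition admissible : Prop :=
  [/\ 0 < jmath C, 0 < nu C & 0 < nu_r C] /\
  [/\ 0 < c_a C, 0 < c_d C, 0 < c_0 C & 0 < c_2].

Context (T : R) (N : nat).

Definition tau : R := T / N%:R.
Definition time (n : nat) : R := n%:R * tau.
Definition sav_weight (n : nat) : R := expR (- time n / T).

Context {d : nat} (Omega : set 'rV[R]_d).
Context (u : nat -> vfield R d) (p : nat -> 'rV[R]_d -> R)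
        (w : nat -> vfield R d) (q : nat -> R).

Definition delta_t (v : nat -> vfield R d) (n : nat) : vfield R d :=
  fun k x => (v n.+1 k x - v n k x) / tau.

Local Notation "''(' f , g )" := (vinner Omega f g).
Local Notation conv := (convection Omega).
Local Notation div := (divergence Omega).

(* The integrals (u . grad u, v) converge for H^1_0 fields by the Sobolev
   embedding H^1_0 -> L^4, valid for d <= 3. *)
Definition momentum_eq (n : nat) : Prop := forall v, X_vel Omega v ->
  '(delta_t u n, v)
  + q n.+1 / sav_weight n.+1 * '(conv (u n) (u n), v)
  + nu_0 * grad_inner Omega (u n.+1) v
  - inner Omega (p n.+1) (div v)
  = 2 * nu_r C * '(curl Omega (w n), v).

Definition angular_eq (n : nat) : Prop := forall s, X_ang Omega s ->
  jmath C * '(delta_t w n, s)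
  + jmath C * (q n.+1 / sav_weight n.+1) * '(conv (u n) (w n), s)
  + c_1 * grad_inner Omega (w n.+1) s
  + c_2 * inner Omega (div (w n.+1)) (div s)
  + 4 * nu_r C * '(w n.+1, s)
  = 2 * nu_r C * '(curl Omega (u n.+1), s).

Definition sav_eq (n : nat) : Prop :=
  (q n.+1 - q n) / tau + T^-1 * q n.+1
  - (sav_weight n.+1)^-1 *
    ('(conv (u n) (u n), u n.+1) + jmath C * '(conv (u n) (w n), w n.+1))
  = 0.

Record sav_solution : Prop := {
  sav_u0 : V_vel Omega (u 0%N);
  sav_w0 : X_ang Omega (w 0%N);
  sav_u : forall n, (n < N)%N -> X_vel Omega (u n.+1);
  sav_p : forall n, (n < N)%N -> L2_zero_mean Omega (p n.+1);
  sav_w : forall n, (n < N)%N -> X_ang Omega (w n.+1);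
  sav_momentum : forall n, (n < N)%N -> momentum_eq n;
  sav_div : forall n, (n < N)%N -> ae_zero Omega (div (u n.+1));
  sav_angular : forall n, (n < N)%N -> angular_eq n;
  sav_scalar : forall n, (n < N)%N -> sav_eq n }.

Definition energy (n : nat) : R :=
  1 / 2 * vnorm Omega (u n) ^+ 2
  + (jmath C + 4 * tau * nu_r C) / 2 * vnorm Omega (w n) ^+ 2
  + 1 / 2 * `|q n| ^+ 2.

End scheme.

(* Main.v *)
Require Import Defs.
From mathcomp Require Import all_boot all_order all_algebra.
From mathcomp Require Import all_classical all_reals all_analysis.
From mathcomp Require Import measurable_realfun.
From mathcomp Require Import ring lra.

Set Implicit Arguments.
Unset Strict Implicit.
Unset Printing Implicit Defensive.

Import Order.TTheory GRing.Theory Num.Theory.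
Import numFieldNormedType.Exports.

Local Open Scope classical_set_scope.
Local Open Scope ring_scope.

(** Test the momentum equation with [u n.+1], the angular momentum equation with
    [w n.+1], and multiply the scalar equation by [q n.+1]. The two convection
    terms are, up to sign, exactly the term that the scalar equation adds, so
    they cancel whatever their values are; the pressure term vanishes because
    [u n.+1] is divergence free. The discrete time derivatives give half the
    increments of the squared norms plus nonnegative squares. What remains to be
    controlled is the coupling

      [2 * nu_r * ((curl (w n), u n.+1) + (curl (u n.+1), w n.+1))].

    Two facts on fields with components in [H10] settle it. The curl is
    selfadjoint (lemma [curl_selfadjoint]), so that the coupling is
    [2 * nu_r * (w n + w n.+1, curl (u n.+1))], and Young's inequality bounds it
    by [nu_r] times [|curl (u n.+1)|^2 + 2 * |w n|^2 + 2 * |w n.+1|^2]. And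
    [|curl u|^2 + |div u|^2 = |grad u|^2] (lemma [curl_div_grad]), so that the
    first term is absorbed by the part [nu_r] of the viscosity
    [nu_0 = nu + nu_r] with constant exactly 1. The remaining terms are absorbed
    by [4 * nu_r * |w n.+1|^2], at the price of the correction
    [4 * tau * nu_r] to the coefficient of [|w|^2] in the energy. Lemma
    [energy_balance] is this computation.

    Both facts follow from integration by parts and from the symmetry
    [(d_i f, d_j g) = (d_j f, d_i g)] for [f] and [g] in [H10]. By the
    Cauchy-Schwarz inequality it suffices to prove these when [g] is a test
    function (lemma [H10_density]), where the first is the definition of weak
    derivatives and the second follows from it because mixed partial derivatives of
    smooth functions commute (lemma [derive_comm]). Test functions are square
    integrable because they are bounded, continuous functions are measurable for
    the product sigma-algebra (lemma [open_measurable_rV]) and balls have finite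
    measure (lemma [lebesgue_rV_ball_lty]). *)

(** * Symmetry of mixed directional derivatives *)

Section directional_derivatives.
Context {R : realType} {V : normedModType R}.
Implicit Types (f : V -> R) (x v w : V).

Lemma derive_line f x v (s : R) : derivable f (x + s *: v) v ->
  is_derive s (1 : R) (fun t : R => f (x + t *: v)) ('D_v f (x + s *: v)).
Proof.
have E : (fun h : R => h^-1 *: (((fun t : R => f (x + t *: v)) \o shift s)
            (h *: (1 : R)) - f (x + s *: v))) =
         (fun h : R => h^-1 *: ((f \o shift (x + s *: v)) (h *: v)
            - f (x + s *: v))).
  apply/funext => h /=; congr (_ *: (f _ - _)).
  by rewrite [h *: (1 : R)]mulr1 scalerDl addrCA.
by move=> df; apply: DeriveDef; rewrite /derivable /derive E.
Qed.

Lemma mean_value_line f x v (h : R) : 0 < h ->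
  (forall y, derivable f y v) ->
  exists2 c, 0 < c < h & f (x + h *: v) - f x = h * 'D_v f (x + c *: v).
Proof.
move=> h0 df; pose g (t : R) := f (x + t *: v).
have dg s : is_derive s (1 : R) g ('D_v f (x + s *: v)) by exact: derive_line.
have [|c + E] := @MVT R g (fun s => 'D_v f (x + s *: v)) 0 h h0 (fun s _ => dg s).
  by apply: derivable_within_continuous => s _; have [] := dg s.
rewrite in_itv /= => ch; exists c => //.
by move: E; rewrite /g scale0r addr0 subr0 mulrC.
Qed.

(** The mean value theorem is applied twice: along [v] to the increment of [f] in
    the direction [w], and then along [w] to ['D_v f]. *)
Lemma second_difference f x v w (h : R) : 0 < h ->
  (forall y, derivable f y v) -> (forall y, derivable ('D_v f) y w) ->
  exists a b, [/\ 0 < a < h, 0 < b < h &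
    f (x + h *: v + h *: w) - f (x + h *: v) - f (x + h *: w) + f x =
    h ^+ 2 * 'D_w ('D_v f) (x + a *: v + b *: w)].
Proof.
move=> h0 df ddf; pose g y := f (y + h *: w) - f y.
have shiftw y : (fun z => f (z + h *: w)) \o shift y = f \o shift (y + h *: w).
  by apply/funext => z /=; rewrite addrA.
have dgs y : derivable (fun z => f (z + h *: w)) y v.
  by have := df (y + h *: w); rewrite /derivable -shiftw.
have dg y : derivable g y v by exact: derivableB.
have Dg y : 'D_v g y = 'D_v f (y + h *: w) - 'D_v f y.
  have -> : 'D_v f (y + h *: w) = 'D_v (fun z => f (z + h *: w)) y.
    by rewrite /derive shiftw.
  exact: deriveB (dgs y) (df y).
have [a a0h Ea] := mean_value_line x h0 dg.
have [b b0h Eb] := mean_value_line (x + a *: v) h0 ddf.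
exists a, b; split => //.
by rewrite expr2 -mulrA -Eb -Dg -Ea /g opprB addrA addrAC.
Qed.

Lemma eq_of_close_values (A B : V -> R) x :
  {for x, continuous A} -> {for x, continuous B} ->
  (forall r : R, 0 < r -> exists y z,
     [/\ `|y| < r, `|z| < r & A (x + y) = B (x + z)]) ->
  A x = B x.
Proof.
move=> cA cB close.
apply/eqP; rewrite -subr_eq0 -normr_le0; apply/ler_addgt0Pl => e e0.
rewrite addr0; have e20 : 0 < e / 2 by rewrite divr_gt0.
have /cvgrPdist_lt/(_ _ e20)/nbhs_ballP[d1 /= d10 B1] := cA.
have /cvgrPdist_lt/(_ _ e20)/nbhs_ballP[d2 /= d20 B2] := cB.
have r0 : 0 < Num.min d1 d2 by rewrite lt_min d10.
have [y [z [yr zr E]]] := close _ r0.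
have /B1 /= H1 : ball x d1 (x + y).
  rewrite -ball_normE /ball_ /= opprD addrA subrr sub0r normrN.
  by rewrite (lt_le_trans yr)// ge_min lexx.
have /B2 /= H2 : ball x d2 (x + z).
  rewrite -ball_normE /ball_ /= opprD addrA subrr sub0r normrN.
  by rewrite (lt_le_trans zr)// ge_min lexx orbT.
rewrite (_ : A x - B x = (A x - A (x + y)) + (B (x + z) - B x)).
  rewrite (le_trans (ler_normD _ _))// (splitr e) lerD//; first exact: ltW.
  by rewrite distrC ltW.
by rewrite -E addrA subrK.
Qed.

(** The second difference of [f] along [v] and [w] is symmetric in [v] and [w];
    by the mean value theorem it equals, up to the factor [h ^+ 2], each of the
    two mixed derivatives at some point of the parallelogram. Continuity
    identifies the limits as [h] tends to 0. *)
Lemma derive_comm f x v w :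
  (forall y, derivable f y v) -> (forall y, derivable f y w) ->
  (forall y, derivable ('D_v f) y w) -> (forall y, derivable ('D_w f) y v) ->
  {for x, continuous ('D_w ('D_v f))} -> {for x, continuous ('D_v ('D_w f))} ->
  'D_w ('D_v f) x = 'D_v ('D_w f) x.
Proof.
move=> dv dw dvw dwv cvw cwv.
apply: (eq_of_close_values cvw cwv) => r r0.
have n0 : 0 < `|v| + `|w| + 1 by rewrite ltr_wpDl// addr_ge0.
pose h := r / (`|v| + `|w| + 1); have h0 : 0 < h by rewrite divr_gt0.
have small a b : 0 < a < h -> 0 < b < h -> `|a *: v + b *: w| < r.
  move=> /andP[a0 ah] /andP[b0 bh].
  rewrite (le_lt_trans (ler_normD _ _))// !normrZ !gtr0_norm//.
  apply: (@le_lt_trans _ _ (h * (`|v| + `|w|))).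
    by rewrite mulrDr lerD// ler_wpM2r// ltW.
  by rewrite /h mulrAC ltr_pdivrMr// ltr_pM2l// ltrDl.
have [a [b [ah bh E1]]] := second_difference x h0 dv dvw.
have [a' [b' [ah' bh' E2]]] := second_difference x h0 dw dwv.
exists (a *: v + b *: w), (a' *: w + b' *: v); split; first exact: small.
  by rewrite addrC; exact: small.
have hn0 : h ^+ 2 != 0 by rewrite expf_neq0// gt_eqF.
rewrite !addrA; apply: (mulfI hn0); apply: (etrans (esym E1)).
apply: etrans E2; rewrite (addrAC x (h *: w)).
by congr (_ + _); rewrite [LHS]addrAC.
Qed.

End directional_derivatives.

(** * Borel sets and balls in row spaces *)

Section borel.
Context {R : realType}.

Lemma measurable_ball_rV n (c : 'rV[R]_n) (r : R) : measurable (ball c r).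
Proof.
(* A ball of nonpositive radius is empty. *)
have [r0|r0] := leP r 0.
  rewrite (_ : ball c r = set0)//; apply/seteqP; split => // y [+ _].
  by rewrite ltNge r0.
rewrite (_ : ball c r = \big[setI/setT]_(i < n)
    ((fun x : 'rV[R]_n => x ord0 i : measurableTypeR R) @^-1` ball (c ord0 i) r)).
  apply: bigsetI_measurable => i _; rewrite -[X in measurable X]setTI.
  by apply: measurable_coord_rV => //; exact: measurable_ball.
rewrite -bigcap_seq; apply/seteqP; split=> [y [_ cy] i _|y cy] /=; first exact: cy.
by split=> // i j; rewrite ord1; apply: cy; rewrite /= mem_index_enum.
Qed.

(** A row space is second countable: every open set is a union of balls with
    rational centres and radii of the form [k.+1%:R^-1]. *)
Lemma open_measurable_rV n (U : set 'rV[R]_n) : open U -> measurable U.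
Proof.
move=> oU.
pose B (i : 'rV[rat]_n * nat) : set 'rV[R]_n :=
  ball (map_mx ratr i.1 : 'rV[R]_n) i.2.+1%:R^-1.
pose F i := if `[< B i `<=` U >] then B i else set0.
rewrite (_ : U = \bigcup_i F i); last first.
  apply/seteqP; split=> [x Ux|x [i _]]; last first.
    by rewrite /F; case: ifP => // /asboolP BU /BU.
  have /nbhs_ballP[e /= e0 eU] : nbhs x U by exact: open_nbhs_nbhs.
  have [k ke] : exists k, k.+1%:R^-1 < e / 2.
    near \oo => k; exists k; near: k.
    by apply: near_infty_natSinv_lt (PosNum (divr_gt0 e0 _)).
  have k0 : 0 < k.+1%:R^-1 :> R by rewrite invr_gt0.
  have /choice[q qx] (j : 'I_n) : exists a : rat,
      `|x ord0 j - ratr a| < k.+1%:R^-1.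
    have [|a] := @rat_in_itvoo R (x ord0 j - k.+1%:R^-1) (x ord0 j + k.+1%:R^-1).
      by rewrite ltrD2l gtrN.
    by rewrite in_itv /= => xa; exists a; rewrite distrC ltr_distl.
  pose c : 'rV[R]_n := map_mx ratr (\row_j q j).
  have xc : ball c k.+1%:R^-1 x.
    by split=> // i j; rewrite ord1 !mxE; apply: ball_sym; exact: qx.
  exists (\row_j q j, k) => //; rewrite /F; case: asboolP => // [[]] y cy.
  apply: eU; rewrite (splitr e); apply: le_ball (ball_triangle (ball_sym xc) cy).
  by rewrite lerD// ltW.
apply: countable_bigcupT_measurable; first exact: countableP.
by move=> i; rewrite /F; case: ifP => // _; exact: measurable_ball_rV.
Unshelve. all: by end_near. Qed.

Lemma continuous_measurable_fun_rV n (f : 'rV[R]_n -> R) :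
  continuous f -> measurable_fun setT (f : 'rV[R]_n -> measurableTypeR R).
Proof.
move=> /continuousP cf; apply: (measurability _ (RGenOpens.measurableE R)).
move=> _ [_ [a [b ->] <-]]; rewrite setTI; apply: open_measurable_rV.
exact/cf/interval_open.
Qed.

(** The norm being the maximum norm, a ball of [R^n.+1] is contained in the
    product of an interval and a ball of [R^n]. *)
Lemma lebesgue_rV_ball_lty n (r : R) : (lebesgue_rV n (ball 0%R r) < +oo)%E.
Proof.
have [r0|r0] := leP r 0.
  rewrite (_ : ball _ r = set0) ?measure0//; apply/seteqP; split => // y [+ _].
  by rewrite ltNge r0.
elim: n => [|n IH]; first by rewrite /= diracE ltry.
rewrite /= /lebesgue_rVS /pushforward.
apply: (@le_lt_trans _ _ ((@lebesgue_measure R \x lebesgue_rV n)%E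
   (ball (0 : R) r `*` ball (0 : 'rV[R]_n) r))).
  apply: le_measure; rewrite ?inE.
  - rewrite -[X in measurable X]setTI; apply: measurable_cons_rV => //.
    exact: measurable_ball_rV.
  - by apply: measurableX; [exact: measurable_ball|exact: measurable_ball_rV].
  - move=> z [_ bz]; have := @cons_rVK R n z; rewrite /uncons_rV => {1}<-; split.
      by have := bz ord0 ord0; rewrite mxE.
    by split=> // i j; have := bz i (rshift 1 j); rewrite !mxE ord1.
rewrite product_measure1E; [|exact: measurable_ball|exact: measurable_ball_rV].
have ballE := lebesgue_measure_ball 0 (ltW r0).
apply: lte_mul_pinfty => //; rewrite [X in X \is a fin_num]ballE//.
Qed.

End borel.

(** * Square integrable functions *)

Section L2_inner.
Context {R : realType} {d : nat} (Omega : set 'rV[R]_d).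
Implicit Types f g h : 'rV[R]_d -> R.

Let mu := lebesgue_rV (R := R) d.
Local Notation L2 := (L2 Omega).
Local Notation inner := (inner Omega).
Local Notation L2norm := (L2norm Omega).

Let p1 : (1 <= 2%:E :> \bar R)%E. Proof. by rewrite lee_fin ler1n. Qed.

Lemma L2_0 : L2 0.
Proof.
rewrite /Defs.L2 (_ : 0 \_ Omega = 0); first by have [] := Lfun_addr_closed mu p1.
by apply/funext => x; rewrite patchE; case: ifP.
Qed.

Lemma L2D f g : L2 f -> L2 g -> L2 (f + g).
Proof.
rewrite /Defs.L2 => Lf Lg.
rewrite (_ : (f + g) \_ Omega = f \_ Omega + g \_ Omega).
  by have [_] := Lfun_addr_closed mu p1; exact.
by apply/funext => x; rewrite /= !fctE !patchE; case: ifP; rewrite ?addr0.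
Qed.

Lemma L2Z (a : R) f : L2 f -> L2 (a *: f).
Proof.
rewrite /Defs.L2 => Lf; rewrite (_ : (a *: f) \_ Omega = a \o* (f \_ Omega)).
  by apply: Lfun_scale => //; rewrite ler1n.
apply/funext => x; rewrite /= !patchE; case: ifP; rewrite ?mul0r//.
by rewrite mulrC.
Qed.

Lemma L2N f : L2 f -> L2 (- f).
Proof. by rewrite -scaleN1r; exact: L2Z. Qed.

Lemma L2B f g : L2 f -> L2 g -> L2 (f - g).
Proof. by move=> Lf Lg; apply: L2D => //; exact: L2N. Qed.

(** Extension by zero turns integrals over [Omega] into integrals over the whole
    space, where a product of square integrable functions is integrable. *)
Lemma inner_integrable f g : L2 f -> L2 g ->
  mu.-integrable setT (EFin \o ((f * g) \_ Omega)).
Proof.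
move=> Lf Lg; apply/Lfun1_integrable.
rewrite (_ : _ \_ Omega = (f \_ Omega) \* (g \_ Omega)); first exact: Lfun2_mul_Lfun1.
by apply/funext => x; rewrite /= !patchE; case: ifP; rewrite ?mulr0.
Qed.

Lemma innerC f g : inner f g = inner g f.
Proof. by apply: eq_Rintegral => x _; rewrite mulrC. Qed.

Lemma innerE f g : inner f g = \int[mu]_x ((f * g) \_ Omega) x.
Proof. exact: Rintegral_mkcond. Qed.

Lemma innerDl f g h : L2 f -> L2 g -> L2 h ->
  inner (f + g) h = inner f h + inner g h.
Proof.
move=> Lf Lg Lh; rewrite !innerE -RintegralD//; [|exact: inner_integrable..].
apply: eq_Rintegral => x _; rewrite !patchE; case: ifP; rewrite ?addr0// => _.
by rewrite mulrDl.
Qed.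

Lemma innerZl a f g : L2 f -> L2 g -> inner (a *: f) g = a * inner f g.
Proof.
move=> Lf Lg; rewrite !innerE -RintegralZl//; last exact: inner_integrable.
apply: eq_Rintegral => x _; rewrite !patchE; case: ifP; rewrite ?mulr0// => _.
by rewrite mulrA.
Qed.

Lemma innerNl f g : L2 f -> L2 g -> inner (- f) g = - inner f g.
Proof. by move=> Lf Lg; rewrite -scaleN1r innerZl// mulN1r. Qed.

Lemma innerBl f g h : L2 f -> L2 g -> L2 h ->
  inner (f - g) h = inner f h - inner g h.
Proof. by move=> Lf Lg Lh; rewrite innerDl ?innerNl//; exact: L2N. Qed.

Lemma innerDr f g h : L2 f -> L2 g -> L2 h ->
  inner h (f + g) = inner h f + inner h g.
Proof. by move=> *; rewrite !(innerC h) innerDl. Qed.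

Lemma innerBr f g h : L2 f -> L2 g -> L2 h ->
  inner h (f - g) = inner h f - inner h g.
Proof. by move=> *; rewrite !(innerC h) innerBl. Qed.

Lemma innerZr a f g : L2 f -> L2 g -> inner f (a *: g) = a * inner f g.
Proof. by move=> *; rewrite !(innerC f) innerZl. Qed.

Lemma inner0l f : inner 0 f = 0.
Proof.
rewrite innerE; under eq_Rintegral => x _.
  rewrite patchE mul0r if_same; over.
by rewrite /Rintegral integral0.
Qed.

Lemma inner0r f : inner f 0 = 0.
Proof. by rewrite innerC inner0l. Qed.

Lemma inner_ge0 f : 0 <= inner f f.
Proof. by apply: Rintegral_ge0 => x _; rewrite -expr2 sqr_ge0. Qed.

Lemma L2norm_sqr f : L2norm f ^+ 2 = inner f f.
Proof. by rewrite sqr_sqrtr// inner_ge0. Qed.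

Lemma cauchy_schwarz f g : L2 f -> L2 g ->
  `|inner f g| <= L2norm f * L2norm g.
Proof.
move=> Lf Lg; rewrite -sqrtrM ?inner_ge0// -sqrtr_sqr ler_wsqrtr//.
set a := inner f f; set b := inner f g; set c := inner g g.
have quad s t : 0 <= s ^+ 2 * a + 2 * (s * t * b) + t ^+ 2 * c.
  have := inner_ge0 (s *: f + t *: g).
  have Lsf := L2Z s Lf; have Ltg := L2Z t Lg; have Lst := L2D Lsf Ltg.
  rewrite innerDl// !innerDr// !innerZl// !innerZr// (innerC g f).
  by rewrite -/a -/b -/c; lra.
have [c0|c0] : 0 < c \/ c = 0.
  by have := inner_ge0 g; rewrite -/c le_eqVlt => /orP[/eqP|]; [right|left].
  (* The choice of [s] and [t] that makes [s *: f + t *: g] orthogonal to [g]. *)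
  have := quad c (- b).
  rewrite (_ : _ + _ = c * (a * c - b ^+ 2)); last by ring.
  by rewrite pmulr_rge0// subr_ge0.
(* When [c = 0] this makes the quadratic form equal to [- b ^+ 2]. *)
have := quad b (- (a + 1) / 2).
have := inner_ge0 f; rewrite -/a c0 => a0; nra.
Qed.

Lemma inner_ae_zero f g : L2 f -> L2 g -> ae_zero Omega g -> inner f g = 0.
Proof.
move=> Lf Lg g0; rewrite innerE /Rintegral.
rewrite (@ae_eq_integral _ _ _ _ _ (cst 0%E))//; first by rewrite integral0.
- by have /integrableP[] := inner_integrable Lf Lg.
- apply: filterS g0 => x g0 _ /=; rewrite patchE; case: ifP => // /set_mem /g0 E.
  by rewrite /= !fctE E mulr0.
Qed.

End L2_inner.

(** * Test functions and the space H^1_0 *)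

Section test_functions.
Context {R : realType} {d : nat} (Omega : set 'rV[R]_d).
Implicit Types (f g phi : 'rV[R]_d -> R) (i j : 'I_d).

Let mu := lebesgue_rV (R := R) d.

Lemma smooth_partial phi i : smooth phi -> smooth (partial i phi).
Proof. by move=> sphi s /=; rewrite -foldr_rcons; exact: sphi. Qed.

Lemma smooth_continuous phi : smooth phi -> continuous phi.
Proof. by move=> /(_ [::])[]. Qed.

Lemma smooth_derivable phi i x :
  smooth phi -> derivable phi x (delta_mx ord0 i).
Proof. by move=> /(_ [::])[_]. Qed.

Lemma partialC phi i j : smooth phi ->
  partial i (partial j phi) = partial j (partial i phi).
Proof.
move=> sphi; have sp k := smooth_partial k sphi; have spp k l := smooth_partial k (sp l).
apply/funext => x.
exact: (@derive_comm _ _ phi x (delta_mx ord0 j) (delta_mx ord0 i)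
  (fun y => @smooth_derivable _ j y sphi) (fun y => @smooth_derivable _ i y sphi)
  (fun y => @smooth_derivable _ i y (sp j)) (fun y => @smooth_derivable _ j y (sp i))
  (@smooth_continuous _ (spp i j) x) (@smooth_continuous _ (spp j i) x)).
Qed.

(** Off the support of [phi], which is closed, [phi] vanishes in a neighbourhood,
    hence so does its derivative. *)
Lemma partial_support phi i :
  closure [set x | partial i phi x != 0] `<=` closure [set x | phi x != 0].
Proof.
set S := closure [set x | phi x != 0].
suff sub : [set x | partial i phi x != 0] `<=` S.
  by apply: (subset_trans (closure_subset sub)); rewrite -(closure_id S).1//;
    exact: closed_closure.
move=> x; apply: contraPP => Sx /=.
have nx : nbhs x (~` S).
  by apply: open_nbhs_nbhs; split=> //; exact/closed_openC/closed_closure.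
apply/negP; rewrite negbK /partial (@near_eq_derive _ _ _ _ (cst 0)).
  by rewrite derive_cst.
apply: filterS nx => y Sy; apply/eqP/negPn/negP => phiy.
by apply: Sy; exact: subset_closure.
Qed.

Lemma test_function_partial phi i :
  test_function Omega phi -> test_function Omega (partial i phi).
Proof.
move=> [sphi cphi phiO]; split; first exact: smooth_partial.
- exact: subclosed_compact (@closed_closure _ _) cphi (@partial_support _ _).
- exact: subset_trans (@partial_support _ _) phiO.
Qed.

(** A test function is bounded by some [M] and vanishes outside some ball, so its
    square is at most [M ^+ 2] times the indicator of that ball. *)
Lemma test_function_L2 phi : test_function Omega phi -> L2 Omega phi.
Proof.
move=> [sphi cphi phiO].
have phi0 x : ~ closure [set y | phi y != 0] x -> phi x = 0.
  by move=> nx; apply/eqP/negPn/negP => px; apply: nx; exact: subset_closure.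
have cont := smooth_continuous sphi.
rewrite /L2 (_ : phi \_ Omega = phi); last first.
  apply/funext => x; rewrite patchE; case: ifPn => // /negP Ox; rewrite phi0//.
  by move=> /phiO /mem_set.
have mphi := continuous_measurable_fun_rV cont.
rewrite inE; apply/andP; split; first by rewrite inE.
rewrite inE /= /finite_norm unlock /Lnorm poweR_lty//.
have [M M0 BM] : exists2 M : R, 0 < M & forall x, `|phi x| <= M.
  have /compact_bounded/ex_strict_bound_gt0[M M0 BM] :
      compact (phi @` closure [set x | phi x != 0]).
    by apply: continuous_compact => //; exact: continuous_subspaceT.
  exists M => // x.
  have [Sx|/phi0 ->] := pselect (closure [set x | phi x != 0] x).
    by apply/ltW/BM; exists x.
  by rewrite normr0 ltW.
have /ex_strict_bound_gt0[r r0 Br] := compact_bounded cphi.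
have phir x : phi x != 0 -> ball 0 r x.
  move=> px; rewrite -ball_normE /ball_ /= sub0r normrN; apply: Br.
  exact: subset_closure.
apply: (@le_lt_trans _ _ (\int[mu]_x (M ^+ 2 * \1_(ball 0 r) x)%:E)%E).
  apply: ge0_le_integral => //.
  - by move=> x _; exact: poweR_ge0.
  - apply/measurable_EFinP.
    apply/(@measurableT_comp _ _ _ _ _ _ (fun x : R => x `^ 2)%R) => //.
    exact/measurableT_comp.
  - apply/measurable_EFinP; apply: measurable_funM => //.
    by apply: measurable_indic; exact: measurable_ball_rV.
  - move=> x _ /=; rewrite lee_fin powR_mulrn// indicE.
    have [/phir xr|/negPn/eqP ->] := boolP (phi x != 0).
      by rewrite mem_set// mulr1 ler_sqr// nnegrE ltW.
    by rewrite normr0 expr0n /= mulr_ge0 ?sqr_ge0.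
under eq_integral do rewrite EFinM.
rewrite ge0_integralZl//.
- rewrite integral_indic//; last exact: measurable_ball_rV.
  by rewrite setIT lte_mul_pinfty ?lee_fin ?sqr_ge0//; exact: lebesgue_rV_ball_lty.
- by apply/measurable_EFinP/measurable_indic; exact: measurable_ball_rV.
- by rewrite lee_fin sqr_ge0.
Qed.

End test_functions.

Section H10_theory.
Context {R : realType} {d : nat} (Omega : set 'rV[R]_d).
Implicit Types (f g phi : 'rV[R]_d -> R) (i j : 'I_d).
Local Notation L2 := (L2 Omega).
Local Notation inner := (inner Omega).
Local Notation L2norm := (L2norm Omega).
Local Notation H10 := (H10 Omega).
Local Notation wpartial := (wpartial Omega).

Lemma wpartialP f i : H10 f -> weak_partial Omega i f (wpartial i f).
Proof. by move=> [[_ /(_ i) ex] _]; exact: (xgetPex _ ex). Qed.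

Lemma H10_L2 f : H10 f -> L2 f.
Proof. by case=> [[]]. Qed.

Lemma H10_wpartial_L2 f i : H10 f -> L2 (wpartial i f).
Proof. by move=> /(wpartialP i)[]. Qed.

(** Each term is continuous in [g] for the norm of [H^1], by the Cauchy-Schwarz
    inequality, and test functions are dense in [H10]. Three terms cover both
    applications: integration by parts has [c = 0], the exchange of derivatives
    has [a = 0]. *)
Lemma H10_density a b c g i j : H10 g -> L2 a -> L2 b -> L2 c ->
  (forall phi, test_function Omega phi ->
     inner a phi + inner b (partial i phi) = inner c (partial j phi)) ->
  inner a g + inner b (wpartial i g) = inner c (wpartial j g).
Proof.
move=> Hg La Lb Lc test0; apply/eqP; rewrite -subr_eq0 -normr_le0.
set D := _ + _ - _; pose K := L2norm a + L2norm b + L2norm c.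
have N0 h : 0 <= L2norm h by rewrite sqrtr_ge0.
have K0 : 0 <= K by rewrite !addr_ge0.
have cancel3 (x y z x' y' z' : R) : x' + y' = z' ->
    x + y - z = (x - x') + (y - y') - (z - z') by lra.
have DK e : 0 < e -> `|D| <= K * e.
  move=> e0; have [_ /(_ e e0)[phi [tphi ge dge]]] := Hg.
  have Lphi := test_function_L2 tphi.
  have Ldphi k := test_function_L2 (test_function_partial k tphi).
  have Lg := H10_L2 Hg; have Ldg k := H10_wpartial_L2 k Hg.
  have -> : D = inner a (g - phi) + inner b (wpartial i g - partial i phi)
              - inner c (wpartial j g - partial j phi).
    rewrite !innerBr//; exact: cancel3 (test0 _ tphi).
  rewrite (le_trans (ler_normB _ _))// /K 2!mulrDl lerD//; last first.
    rewrite (le_trans (cauchy_schwarz Lc (L2B (Ldg j) (Ldphi j))))//.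
    by rewrite ler_wpM2l// ltW.
  rewrite (le_trans (ler_normD _ _))// lerD//.
    rewrite (le_trans (cauchy_schwarz La (L2B Lg Lphi)))//.
    by rewrite ler_wpM2l// ltW.
  rewrite (le_trans (cauchy_schwarz Lb (L2B (Ldg i) (Ldphi i))))//.
  by rewrite ler_wpM2l// ltW.
apply/ler_addgt0Pl => e e0; rewrite addr0.
have K1 : 0 < K + 1 by rewrite ltr_wpDl.
rewrite (le_trans (DK (e / (K + 1)) _)) ?divr_gt0//.
by rewrite mulrCA ger_pMr// ler_pdivrMr// mul1r lerDl.
Qed.

Lemma H10_by_parts f g i : H10 f -> H10 g ->
  inner f (wpartial i g) = - inner (wpartial i f) g.
Proof.
move=> Hf Hg; have [Ldf wdf] := wpartialP i Hf.
have E : inner (wpartial i f) g + inner f (wpartial i g) = inner 0 (wpartial i g).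
  apply: (H10_density Hg Ldf (H10_L2 Hf) (L2_0 _)) => phi tphi.
  by rewrite inner0l wdf// subrr.
by apply/eqP; rewrite -addr_eq0 addrC E inner0l.
Qed.

(** On test functions both sides are [inner f] against a second derivative of
    [phi], and second derivatives of [phi] commute. *)
Lemma H10_gradient_swap f g i j : H10 f -> H10 g ->
  inner (wpartial i f) (wpartial j g) = inner (wpartial j f) (wpartial i g).
Proof.
move=> Hf Hg; have [Ldi wdi] := wpartialP i Hf; have [Ldj wdj] := wpartialP j Hf.
have E : inner 0 g + inner (wpartial i f) (wpartial j g) =
         inner (wpartial j f) (wpartial i g).
  apply: (H10_density Hg (L2_0 _) Ldi Ldj) => phi tphi.
  have tdphi k := test_function_partial k tphi.
  have [sphi _ _] := tphi; rewrite inner0l add0r; apply: oppr_inj.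
  apply: (etrans (esym (wdi _ (tdphi j)))); apply: etrans (wdj _ (tdphi i)).
  exact: congr1 (partialC i j sphi).
by apply: etrans E; rewrite inner0l add0r.
Qed.

End H10_theory.

(** * Curl, divergence and gradient of vector fields *)

Lemma sum_ord3 (V : nmodType) (F : 'I_3 -> V) : \sum_(k < 3) F k = F 0 + F 1 + F 2.
Proof.
by rewrite !big_ord_recr big_ord0 /= add0r; congr (F _ + F _ + F _); exact: val_inj.
Qed.

Section rotation.
Context {R : realType} {d : nat} (Omega : set 'rV[R]_d).
Local Notation L2 := (L2 Omega).
Local Notation inner := (inner Omega).

Let ord3 : ((0 + 1 = 1 :> 'I_3) * (0 + 2 = 2 :> 'I_3) * (1 + 1 = 2 :> 'I_3) *
  (1 + 2 = 0 :> 'I_3) * (2 + 1 = 0 :> 'I_3) * (2 + 2 = 1 :> 'I_3)).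
Proof. by do !split; exact: val_inj. Qed.

(** In the application [F i k] and [G i k] are the partial derivatives [d_i a_k]
    and [d_i b_k]. With abstract tables only the bookkeeping of indices modulo 3
    is left: after integration by parts, each product of an off-diagonal entry
    of [F] with a component of [b] occurs once on each side, with the same sign. *)
Lemma rotation_by_parts (a b : 'I_3 -> 'rV[R]_d -> R)
    (F G : 'I_3 -> 'I_3 -> 'rV[R]_d -> R) :
  (forall k, L2 (a k)) -> (forall k, L2 (b k)) ->
  (forall i k, L2 (F i k)) -> (forall i k, L2 (G i k)) ->
  (forall i k l, inner (a k) (G i l) = - inner (F i k) (b l)) ->
  \sum_(k < 3) inner (F (k + 1) (k + 2) - F (k + 2) (k + 1)) (b k) =
  \sum_(k < 3) inner (a k) (G (k + 1) (k + 2) - G (k + 2) (k + 1)).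
Proof.
move=> La Lb LF LG parts.
under eq_bigr do rewrite innerBl//.
under [RHS]eq_bigr do rewrite innerBr// !parts.
pose P i k l := inner (F i k) (b l).
have EP i k l : inner (F i k) (b l) = P i k l by [].
by rewrite !sum_ord3 !ord3 !EP; move: P {EP} => P; ring.
Qed.

(** With [F i k] the partial derivative [d_i u_k], the squared curl produces the
    off-diagonal squares minus [2 * inner (F i k) (F k i)] for [i < k], and the
    squared divergence the diagonal squares plus [2 * inner (F i i) (F k k)].
    The symmetry hypothesis makes these products cancel. *)
Lemma rotation_trace_norm (F : 'I_3 -> 'I_3 -> 'rV[R]_d -> R) :
  (forall i k, L2 (F i k)) ->
  (forall i j k l, inner (F i k) (F j l) = inner (F j k) (F i l)) ->
  \sum_(k < 3) inner (F (k + 1) (k + 2) - F (k + 2) (k + 1))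
                     (F (k + 1) (k + 2) - F (k + 2) (k + 1))
    + inner (\sum_(i < 3) F i i) (\sum_(i < 3) F i i) =
  \sum_(k < 3) \sum_(i < 3) inner (F i k) (F i k).
Proof.
move=> LF swap; have LB i j k l : L2 (F i k - F j l) by exact: L2B.
under eq_bigr do rewrite innerBl// !innerBr//.
have L01 : L2 (F 0 0 + F 1 1) by exact: L2D.
have L012 : L2 (F 0 0 + F 1 1 + F 2 2) by exact: L2D.
rewrite (sum_ord3 (fun i => F i i)) !(innerDl, innerDr)//.
pose P i k j l := inner (F i k) (F j l).
have EP i k j l : inner (F i k) (F j l) = P i k j l by [].
have PC i k j l : P i k j l = P j l i k by rewrite -!EP innerC.
have PS i k j l : P i k j l = P j k i l by rewrite -!EP swap.
rewrite !sum_ord3 !ord3 !EP; move: P {EP} PC PS => P PC PS.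
(* Every mixed product is brought to one of [P 0 1 1 0], [P 0 2 2 0], [P 1 2 2 1]. *)
rewrite (PC 1 1 0 0) (PC 2 2 0 0) (PC 2 2 1 1).
rewrite (PS 0 0 1 1) (PS 0 0 2 2) (PS 1 1 2 2).
rewrite (PC 1 0 0 1) (PC 2 0 0 2) (PC 2 1 1 2); ring.
Qed.

End rotation.

Section vector_calculus.
Context {R : realType} {d : nat} (Omega : set 'rV[R]_d).
Implicit Types (f g : 'rV[R]_d -> R) (u v w : vfield R d).
Local Notation inner := (inner Omega).
Local Notation vinner := (vinner Omega).
Local Notation wpd := (wpd Omega).

Definition L2_vfield u := forall k, L2 Omega (u k).
Definition H10_vfield u := forall k, H10 Omega (u k).

Lemma H10_vfield_L2 u : H10_vfield u -> L2_vfield u.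
Proof. by move=> Hu k; exact: H10_L2. Qed.

Lemma wpd_L2 f (i : 'I_3) : H10 Omega f -> L2 Omega (wpd i f).
Proof.
by rewrite /Defs.wpd => Hf; case: insub => [j|]; [exact: H10_wpartial_L2|exact: L2_0].
Qed.

Lemma wpd_by_parts f g (i : 'I_3) : H10 Omega f -> H10 Omega g ->
  inner f (wpd i g) = - inner (wpd i f) g.
Proof.
rewrite /Defs.wpd => Hf Hg; case: insub => [j|]; first exact: H10_by_parts.
by rewrite inner0l inner0r oppr0.
Qed.

Lemma wpd_gradient_swap f g (i j : 'I_3) : H10 Omega f -> H10 Omega g ->
  inner (wpd i f) (wpd j g) = inner (wpd j f) (wpd i g).
Proof.
rewrite /Defs.wpd => Hf Hg; case: insub => [k|]; case: insub => [l|].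
- exact: H10_gradient_swap.
- by rewrite inner0l inner0r.
- by rewrite inner0l inner0r.
- by [].
Qed.

Lemma divergenceE u : divergence Omega u = \sum_(i < 3) wpd i (u i).
Proof. by apply/funext => x; rewrite fct_sumE. Qed.

Lemma curl_L2 u : H10_vfield u -> L2_vfield (curl Omega u).
Proof. by move=> Hu k; apply: L2B; exact: wpd_L2. Qed.

Lemma divergence_L2 u : H10_vfield u -> L2 Omega (divergence Omega u).
Proof.
by move=> Hu; rewrite divergenceE sum_ord3; do !apply: L2D; exact: wpd_L2.
Qed.

Lemma curl_selfadjoint u v : H10_vfield u -> H10_vfield v ->
  vinner (curl Omega u) v = vinner u (curl Omega v).
Proof.
move=> Hu Hv.
apply: (@rotation_by_parts _ _ Omega u v (fun i k => wpd i (u k))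
  (fun i k => wpd i (v k))) => *.
- exact: H10_L2.
- exact: H10_L2.
- exact: wpd_L2.
- exact: wpd_L2.
- exact: wpd_by_parts.
Qed.

Lemma curl_div_grad u : H10_vfield u ->
  vinner (curl Omega u) (curl Omega u)
    + inner (divergence Omega u) (divergence Omega u) = grad_inner Omega u u.
Proof.
move=> Hu; rewrite divergenceE.
apply: (@rotation_trace_norm _ _ Omega (fun i k => wpd i (u k))) => *.
- exact: wpd_L2.
- exact: wpd_gradient_swap.
Qed.

Lemma vinnerC u v : vinner u v = vinner v u.
Proof. by apply: eq_bigr => k _; exact: innerC. Qed.

Lemma vinner_ge0 u : 0 <= vinner u u.
Proof. by apply: sumr_ge0 => k _; exact: inner_ge0. Qed.

Lemma vnorm_sqr u : vnorm Omega u ^+ 2 = vinner u u.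
Proof. by rewrite sqr_sqrtr// vinner_ge0. Qed.

Lemma grad_norm_sqr u : grad_norm Omega u ^+ 2 = grad_inner Omega u u.
Proof.
rewrite sqr_sqrtr//; apply: sumr_ge0 => k _.
by apply: sumr_ge0 => i _; exact: inner_ge0.
Qed.

Lemma vinnerDl u v w : L2_vfield u -> L2_vfield v -> L2_vfield w ->
  vinner (fun k => u k + v k) w = vinner u w + vinner v w.
Proof.
by move=> *; rewrite /Defs.vinner -big_split /=; apply: eq_bigr => k _; rewrite innerDl.
Qed.

Lemma vinner_young u v : L2_vfield u -> L2_vfield v ->
  2 * vinner u v <= vinner u u + vinner v v.
Proof.
move=> Lu Lv; rewrite /Defs.vinner mulr_sumr -big_split /=.
apply: ler_sum => k _; have := inner_ge0 Omega (u k - v k).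
rewrite innerBl ?innerBr//; try exact: L2B.
rewrite (innerC _ (v k)).
move: (inner (u k) (u k)) (inner (u k) (v k)) (inner (v k) (v k)) => a b c; lra.
Qed.

Lemma vinner_add_le u v : L2_vfield u -> L2_vfield v ->
  vinner (fun k => u k + v k) (fun k => u k + v k) <=
  2 * (vinner u u + vinner v v).
Proof.
move=> Lu Lv; rewrite /Defs.vinner -big_split mulr_sumr /=.
apply: ler_sum => k _; have := inner_ge0 Omega (u k - v k).
rewrite innerBl ?innerBr//; try exact: L2B.
rewrite innerDl ?innerDr//; try exact: L2D.
rewrite (innerC _ (v k) (u k)).
move: (inner (u k) (u k)) (inner (u k) (v k)) (inner (v k) (v k)) => a b c; lra.
Qed.

Lemma vinner_delta_t (T : R) (N : nat) (v : nat -> vfield R d) n w :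
  L2_vfield (v n.+1) -> L2_vfield (v n) -> L2_vfield w ->
  vinner (delta_t T N v n) w = (vinner (v n.+1) w - vinner (v n) w) / tau T N.
Proof.
move=> L1 L0 Lw; rewrite /Defs.vinner -sumrB mulr_suml; apply: eq_bigr => k _.
rewrite (_ : delta_t T N v n k = (tau T N)^-1 *: (v n.+1 k - v n k)).
  by rewrite innerZl ?innerBl// 1?mulrC//; exact: L2B.
by apply/funext => x; rewrite /delta_t /= mulrC.
Qed.

End vector_calculus.

(** * The energy estimate *)

(** The scalar content of the estimate. The letters stand for inner products:
    [a0], [a1], [ab] for those of the old and new velocities with each other,
    [b0], [b1], [bb] for those of the angular velocities, [K] and [L] for the
    convection terms, [G], [H], [D] for the dissipation terms, and [curl0],
    [curl1] for those of the old and new angular velocities with the curl of the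
    new velocity. The right-hand side minus the left-hand side is half of
    [(a1 + a0 - 2 * ab) + j * (b1 + b0 - 2 * bb) + (q1 - q0) ^+ 2] plus
    [t * nur * (G + 2 * (b0 + b1) - 2 * (curl0 + curl1))]. *)
Lemma energy_balance (R : realFieldType)
    (t T s j nu nur c1 c2 : R) (a0 a1 ab b0 b1 bb q0 q1 : R)
    (K L G H D curl0 curl1 : R) :
  0 < t -> 0 <= nur -> 0 <= j ->
  2 * ab <= a1 + a0 -> 2 * bb <= b1 + b0 ->
  2 * (curl0 + curl1) <= G + 2 * (b0 + b1) ->
  (a1 - ab) / t + q1 / s * K + (nu + nur) * G = 2 * nur * curl0 ->
  j * ((b1 - bb) / t) + j * (q1 / s) * L + c1 * H + c2 * D + 4 * nur * b1 =
    2 * nur * curl1 ->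
  (q1 - q0) / t + T^-1 * q1 - s^-1 * (K + j * L) = 0 ->
  1 / 2 * a1 + (j + 4 * t * nur) / 2 * b1 + 1 / 2 * `|q1| ^+ 2
    - (1 / 2 * a0 + (j + 4 * t * nur) / 2 * b0 + 1 / 2 * `|q0| ^+ 2) <=
  - t * nu * G - t * c1 * H - t * c2 * D - t / T * `|q1| ^+ 2.
Proof.
move=> t0 nur0 j0 Ia Ib Ic Eu Ew Eq; rewrite !real_normK ?num_real//.
have tn0 : t != 0 by rewrite gt_eqF.
move: s^-1 T^-1 Eu Ew Eq => r c Eu Ew Eq.
have {}Eu : a1 - ab + t * (q1 * r * K) + t * (nu + nur) * G = t * (2 * nur * curl0).
  by rewrite -Eu; field.
have {}Ew : j * (b1 - bb) + t * (j * (q1 * r) * L) + t * c1 * H + t * c2 * D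
    + 4 * t * nur * b1 = t * (2 * nur * curl1).
  by rewrite -Ew; field.
have {}Eq : q1 * (q1 - q0) + t * c * q1 ^+ 2 - t * (q1 * r * K)
    - t * (j * (q1 * r) * L) = 0.
  by rewrite -[RHS](mulr0 (q1 * t)) -Eq; field.
have Jb : 0 <= j * (b1 + b0 - 2 * bb) by rewrite mulr_ge0// subr_ge0.
have Jc : 0 <= t * nur * (G + 2 * (b0 + b1) - 2 * (curl0 + curl1)).
  by rewrite mulr_ge0 ?mulr_ge0 ?subr_ge0// ltW.
have Jq := sqr_ge0 (q1 - q0).
lra.
Qed.

Theorem theorem3p2 (R : realType) (d : nat) (hd : d = 2%N \/ d = 3%N)
    (Omega : set 'rV[R]_d) (hOmega : convex_polyhedral_domain Omega)
    (C : coefficients R) (hC : admissible C)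
    (T : R) (hT : 0 < T) (N : nat) (hN : (1 <= N)%N)
    (u : nat -> vfield R d) (p : nat -> 'rV[R]_d -> R)
    (w : nat -> vfield R d) (q : nat -> R)
    (hsol : sav_solution C T N Omega u p w q)
    (n : nat) (hn : (n < N)%N) :
  energy C T N Omega u w q n.+1 - energy C T N Omega u w q n <=
    - tau T N * nu C * grad_norm Omega (u n.+1) ^+ 2
    - tau T N * c_1 C * grad_norm Omega (w n.+1) ^+ 2
    - tau T N * c_2 C * L2norm Omega (divergence Omega (w n.+1)) ^+ 2
    - tau T N / T * `|q n.+1| ^+ 2.
Proof.
have [[j0 _ nur0] _] := hC.
have t0 : 0 < tau T N by rewrite /tau divr_gt0// ltr0n.
have Xu m : (m <= N)%N -> H10_vfield Omega (u m).
  by case: m => [_|m mN]; [case: (sav_u0 hsol) => -[]|case: (sav_u hsol mN)].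
have Xw m : (m <= N)%N -> H10_vfield Omega (w m).
  by case: m => [_|m mN]; [case: (sav_w0 hsol)|case: (sav_w hsol mN)].
have [Hu0 Hu1] := (Xu n (ltnW hn), Xu n.+1 hn).
have [Hw0 Hw1] := (Xw n (ltnW hn), Xw n.+1 hn).
have [Lu0 Lu1] := (H10_vfield_L2 Hu0, H10_vfield_L2 Hu1).
have [Lw0 Lw1] := (H10_vfield_L2 Hw0, H10_vfield_L2 Hw1).
have Lcurl := curl_L2 Hu1.
have pdiv : inner Omega (p n.+1) (divergence Omega (u n.+1)) = 0.
  have [Lp _] := sav_p hsol hn.
  exact: inner_ae_zero Lp (divergence_L2 Hu1) (sav_div hsol hn).
have Eu := sav_momentum hsol hn (sav_u hsol hn).
have Ew := sav_angular hsol hn (sav_w hsol hn).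
have Eq := sav_scalar hsol hn.
rewrite pdiv subr0 (curl_selfadjoint Hw0 Hu1) vinner_delta_t// in Eu.
rewrite (vinnerC _ (curl _ _)) vinner_delta_t// in Ew.
pose ws : vfield R d := fun k => w n k + w n.+1 k.
have Lws : L2_vfield Omega ws by move=> k; exact: L2D.
have Yu := vinner_young Lu1 Lu0.
have Yw := vinner_young Lw1 Lw0.
(* Young's inequality is applied to [curl (u n.+1)] and the sum of both angular
   velocities; their squared norms are then bounded separately. *)
have Yc := vinner_young Lws Lcurl.
have curl_le : vinner Omega (curl Omega (u n.+1)) (curl Omega (u n.+1)) <=
    grad_inner Omega (u n.+1) (u n.+1).
  by rewrite -curl_div_grad// lerDl inner_ge0.
have {curl_le} Yc : 2 * (vinner Omega (w n) (curl Omega (u n.+1))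
      + vinner Omega (w n.+1) (curl Omega (u n.+1))) <=
    grad_norm Omega (u n.+1) ^+ 2
      + 2 * (vnorm Omega (w n) ^+ 2 + vnorm Omega (w n.+1) ^+ 2).
  rewrite grad_norm_sqr (vnorm_sqr _ (w n)) (vnorm_sqr _ (w n.+1)) -vinnerDl//.
  rewrite (le_trans Yc)// addrC lerD//; exact: vinner_add_le.
rewrite /nu_0 in Eu.
rewrite (vinnerC _ (u n)) -(vnorm_sqr _ (u n.+1)) -grad_norm_sqr in Eu.
rewrite (vinnerC _ (w n)) -(vnorm_sqr _ (w n.+1)) -grad_norm_sqr in Ew.
rewrite -(L2norm_sqr _ (divergence _ _)) in Ew.
rewrite -!vnorm_sqr in Yu Yw.
exact: (energy_balance t0 (ltW nur0) (ltW j0) Yu Yw Yc Eu Ew Eq).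
Qed.
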